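(* QA-stratified Boolean doctrines are in one-to-one correspondence with first-order Boolean doctrines equipped with a quantifier-free fragment. (Here, the componentwise injective natural transformations in QA-stratified Boolean doctrines are supposed to be subset inclusions.)
   Context: $\mathbb{N}$ contains $0$; $\mathsf{BA}$ is the category of Boolean algebras and Boolean homomorphisms. A first-order Boolean doctrine over a category $\mathsf{C}$ with finite products is a functor $\mathbf{P}\colon\mathsf{C}^{\mathrm{op}}\to\mathsf{BA}$ such that (i) for all $X,Y\in\mathsf{C}$ the map $\mathbf{P}(\mathrm{pr}_1)\colon\mathbf{P}(X)\to\mathbf{P}(X\times Y)$ has a right adjoint $(\forall Y)_X$ (as an order-preserving map between posets); and (ii) for every $f\colon X'\to X$ and every $Y$, $\mathbf{P}(f)\circ(\forall Y)_X=(\forall Y)_{X'}\circ\mathbf{P}(f\times\mathrm{id}_Y)$. A quantifier-free fragment of a first-order Boolean doctrine $\mathbf{P}\colon\mathsf{C}^{\mathrm{op}}\to\mathsf{BA}$ is a subfunctor $\mathbf{P}_0\colon\mathsf{C}^{\mathrm{op}}\to\mathsf{BA}$ of $\mathbf{P}$ (each $\mathbf{P}_0(X)$ is a Boolean subalgebra of $\mathbf{P}(X)$, and each $\mathbf{P}(f)$ restricts to $\mathbf{P}_0(f)$) such that, for each $X$, $\mathbf{P}(X)=\bigcup_{n\in\mathbb{N}}\mathbf{P}_n(X)$, where, inductively for $n\ge 0$, $\mathbf{P}_{n+1}(X)$ is the Boolean subalgebra of $\mathbf{P}(X)$ generated by the union, over all objects $Y$ of $\mathsf{C}$, of the images of $\mathbf{P}_n(X\times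 Y)$ under $(\forall Y)_X$. A QA-one-step Boolean doctrine over a category $\mathsf{C}$ with finite products is a componentwise injective natural transformation $i\colon\mathbf{P}_0\hookrightarrow\mathbf{P}_1$ between functors $\mathsf{C}^{\mathrm{op}}\to\mathsf{BA}$ such that: (1) for all $X,Y\in\mathsf{C}$ and $\beta\in\mathbf{P}_0(X\times Y)$ there is a (necessarily unique) element $(\forall Y)_X\beta\in\mathbf{P}_1(X)$ such that for all $\alpha\in\mathbf{P}_1(X)$: $\alpha\le(\forall Y)_X\beta$ iff $\mathbf{P}_1(\mathrm{pr}_1)(\alpha)\le i_{X\times Y}(\beta)$; (2) for every $f\colon X'\to X$ and every $Y$, $\mathbf{P}_1(f)\circ(\forall Y)_X=(\forall Y)_{X'}\circ\mathbf{P}_0(f\times\mathrm{id}_Y)$; (3) for all $X$, the Boolean algebra $\mathbf{P}_1(X)$ is generated by the union over $Y\in\mathsf{C}$ of the images of $(\forall Y)_X\colon\mathbf{P}_0(X\times Y)\to\mathbf{P}_1(X)$. A QA-stratified Boolean doctrine over a category $\mathsf{C}$ with finite products is a sequence of functors $(\mathbf{P}_n\colon\mathsf{C}^{\mathrm{op}}\to\mathsf{BA})_{n\in\mathbb{N}}$ and QA-one-step Boolean doctrines $(i_n\colon\mathbf{P}_n\hookrightarrow\mathbf{P}_{n+1})_{n\in\mathbb{N}}$, with one-step quantifiers $(\forall Y)_{X,n}\colon\mathbf{P}_n(X\times Y)\to\mathbf{P}_{n+1}(X)$, such that $(i_{n+1})_X\circ(\forall Y)_{X,n}=(\forall Y)_{X,n+1}\circ(i_n)_{X\times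 Y}$ for all $X,Y\in\mathsf{C}$ and $n\in\mathbb{N}$. *)

(* Defs.v *)
From mathcomp Require Import all_boot.
From mathcomp Require Import boolp classical_sets.

Set Implicit Arguments.
Unset Strict Implicit.
Unset Printing Implicit Defensive.

Local Open Scope classical_set_scope.

(* [compose g f] is "g after f"; the finite products are chosen. *)
Record fpcategory := FPCategory {
  ob :> Type;
  hom : ob -> ob -> Type;
  idm : forall X, hom X X;
  compose : forall X Y Z, hom Y Z -> hom X Y -> hom X Z;
  comp1m : forall X Y (f : hom X Y), compose (idm Y) f = f;
  compm1 : forall X Y (f : hom X Y), compose f (idm X) = f;
  compA : forall X Y Z W (h : hom Z W) (g : hom Y Z) (f : hom X Y),
    compose h (compose g f) = compose (compose h g) f;
  termo : ob;
  bang : forall X, hom X termo;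
  bang_uniq : forall X (f : hom X termo), f = bang X;
  prodo : ob -> ob -> ob;
  pr1 : forall X Y, hom (prodo X Y) X;
  pr2 : forall X Y, hom (prodo X Y) Y;
  pairing : forall Z X Y, hom Z X -> hom Z Y -> hom Z (prodo X Y);
  pair1 : forall Z X Y (f : hom Z X) (g : hom Z Y),
    compose (pr1 X Y) (pairing f g) = f;
  pair2 : forall Z X Y (f : hom Z X) (g : hom Z Y),
    compose (pr2 X Y) (pairing f g) = g;
  pair_uniq : forall Z X Y (h : hom Z (prodo X Y)),
    h = pairing (compose (pr1 X Y) h) (compose (pr2 X Y) h) }.

Arguments idm {f} X : rename.
Arguments pr1 {f} X Y : rename.
Arguments pr2 {f} X Y : rename.

(* f x id_Y : X' x Y -> X x Y *)
Definition prodid (C : fpcategory) (X' X : C) (f : hom X' X) (Y : C) :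
    hom (prodo X' Y) (prodo X Y) :=
  pairing (compose f (pr1 X' Y)) (pr2 X' Y).

(* The objects of BA are Boolean algebras whose underlying set is a set of
   elements of an ambient type U, which plays the role of the universe of sets:
   this is what makes "subset inclusion" between two Boolean algebras, and
   equality of two Boolean algebras, literally meaningful.  Order.CTBDistrLattice
   is not used because it also carries a choice operator on the carrier, which is
   not part of the data of a Boolean algebra and would spoil equality.
   The one-element Boolean algebra is allowed. *)
Record boolalg (U : Type) := BoolAlg {
  carrier :> set U;
  meet : carrier -> carrier -> carrier;
  join : carrier -> carrier -> carrier;
  compl : carrier -> carrier;
  bot : carrier;
  top : carrier;
  meetC : commutative meet;
  joinC : commutative join;
  meetA : associative meet;
  joinA : associative join;
  meet_absorb : forall a b, meet a (join a b) = a;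
  join_absorb : forall a b, join a (meet a b) = a;
  meet_joinl : left_distributive meet join;
  join0b : left_id bot join;
  meet1b : left_id top meet;
  meet_compl : forall a, meet a (compl a) = bot;
  join_compl : forall a, join a (compl a) = top }.

Arguments bot {U} _.
Arguments top {U} _.

Definition ble (U : Type) (A : boolalg U) (a b : A) : Prop := meet a b = a.

Definition is_bahom (U : Type) (A B : boolalg U) (h : A -> B) : Prop :=
  [/\ {morph h : a b / meet a b >-> meet a b},
      {morph h : a b / join a b >-> join a b},
      {morph h : a / compl a >-> compl a},
      h (bot A) = bot B
    & h (top A) = top B].

Definition is_subalg (U : Type) (A : boolalg U) (S : set A) : Prop :=
  [/\ forall a b, S a -> S b -> S (meet a b),
      forall a b, S a -> S b -> S (join a b),
      forall a, S a -> S (compl a),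
      S (bot A)
    & S (top A)].

Definition generated (U : Type) (A : boolalg U) (G : set A) : set A :=
  smallest (@is_subalg U A) G.

(* functors C^op -> BA *)
Record bafunctor (C : fpcategory) (U : Type) := BAFunctor {
  fobj :> C -> boolalg U;
  fmap : forall X' X, hom X' X -> fobj X -> fobj X';
  fmap_bahom : forall X' X (f : hom X' X), is_bahom (fmap f);
  fmap_id : forall X (a : fobj X), fmap (idm X) a = a;
  fmap_comp : forall X'' X' X (f : hom X' X) (g : hom X'' X') (a : fobj X),
    fmap (compose f g) a = fmap g (fmap f a) }.

Arguments fmap {C U} P {X' X} f a : rename.

Definition is_nattrans (C : fpcategory) (U : Type) (P Q : bafunctor C U)
    (h : forall X, P X -> Q X) : Prop :=
  (forall X, is_bahom (h X)) /\
  (forall X' X (f : hom X' X) (a : P X), h X' (fmap P f a) = fmap Q f (h X a)).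

Record fo_doctrine (C : fpcategory) (U : Type) := FODoctrine {
  fo_functor :> bafunctor C U;
  fo_all : forall X Y : C, fo_functor (prodo X Y) -> fo_functor X;
  fo_adj : forall (X Y : C) (a : fo_functor X) (b : fo_functor (prodo X Y)),
    ble a (fo_all b) <-> ble (fmap fo_functor (pr1 X Y) a) b;
  fo_bc : forall (X' X : C) (f : hom X' X) (Y : C)
      (b : fo_functor (prodo X Y)),
    fmap fo_functor f (fo_all b) = fo_all (fmap fo_functor (prodid f Y) b) }.

Arguments fo_all {C U} P {X Y} b : rename.

Fixpoint layer (C : fpcategory) (U : Type) (P : fo_doctrine C U)
    (P0 : forall X, set (P X)) (n : nat) (X : C) : set (P X) :=
  if n is m.+1
  then generated (\bigcup_(Y : C) (@fo_all C U P X Y @` @layer C U P P0 m (prodo X Y)))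
  else P0 X.

Arguments layer {C U P} P0 n X : rename.

Record is_qf_fragment (C : fpcategory) (U : Type) (P : fo_doctrine C U)
    (P0 : forall X, set (P X)) : Prop := IsQFFragment {
  qf_subalg : forall X, is_subalg (P0 X);
  qf_fmap : forall X' X (f : hom X' X) (a : P X), P0 X a -> P0 X' (fmap P f a);
  qf_exhaust : forall X, \bigcup_n layer P0 n X = setT }.

Record fo_doctrine_qf (C : fpcategory) (U : Type) := FODoctrineQF {
  foqf_doctrine :> fo_doctrine C U;
  foqf_fragment : forall X, set (foqf_doctrine X);
  foqf_is_fragment : is_qf_fragment foqf_fragment }.

Record qa_one_step (C : fpcategory) (U : Type) (P0 P1 : bafunctor C U) :=
  QAOneStep {
  os_incl : forall X, P0 X -> P1 X;
  os_nattrans : is_nattrans os_incl;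
  os_inj : forall X, injective (@os_incl X);
  os_all : forall X Y : C, P0 (prodo X Y) -> P1 X;
  os_adj : forall (X Y : C) (b : P0 (prodo X Y)) (a : P1 X),
    ble a (os_all b) <-> ble (fmap P1 (pr1 X Y) a) (os_incl b);
  os_bc : forall (X' X : C) (f : hom X' X) (Y : C) (b : P0 (prodo X Y)),
    fmap P1 f (os_all b) = os_all (fmap P0 (prodid f Y) b);
  os_gen : forall X, generated (\bigcup_(Y : C) range (@os_all X Y)) = setT }.

Arguments os_incl {C U P0 P1} i {X} a : rename.
Arguments os_all {C U P0 P1} i {X Y} b : rename.

Record qa_stratified (C : fpcategory) (U : Type) := QAStratified {
  qa_level :> nat -> bafunctor C U;
  qa_step : forall n, qa_one_step (qa_level n) (qa_level n.+1);
  qa_compat : forall n (X Y : C) (b : qa_level n (prodo X Y)),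
    os_incl (qa_step n.+1) (os_all (qa_step n) b)
    = os_all (qa_step n.+1) (os_incl (qa_step n) b) }.

(* QA-stratified Boolean doctrines whose i_n are subset inclusions *)
Record qa_stratified_sub (C : fpcategory) (U : Type) := QAStratifiedSub {
  qas_stratified :> qa_stratified C U;
  qas_subset : forall n X (a : qas_stratified n X),
    \val (os_incl (qa_step qas_stratified n) a) = \val a }.

(* S is the sequence (P_n)_n attached to (P, P_0): the levels of S are the
   layers of P, as subsets of U, with the Boolean operations, the reindexing
   maps and the quantifiers of S inherited from P. *)
Definition is_stratification (C : fpcategory) (U : Type)
    (P : fo_doctrine_qf C U) (S : qa_stratified_sub C U) : Prop :=
  exists j : forall n X, S n X -> P X,
    [/\ forall n X (a : S n X), \val (j n X a) = \val a,
        forall n X, range (j n X) = layer (@foqf_fragment C U P) n X,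
        forall n, is_nattrans (j n)
      & forall n (X Y : C) (b : S n (prodo X Y)),
          j n.+1 X (os_all (qa_step S n) b) = fo_all P (j n (prodo X Y) b)].

(* Main.v *)
Require Import Defs.
From mathcomp Require Import all_boot.
From mathcomp Require Import boolp classical_sets.

(** The levels attached to [(P, P0)] are the layers of [P]; they increase
because, [1] being terminal, [a] is the quantification over [1] of its own
reindexing along the isomorphism [X x 1 -> X].  Conversely the levels of a
stratified doctrine have a directed union, and every operation on it is
computed at a large enough level.  Since all inclusions are identities on the
ambient type [U], a doctrine and a stratification related by
[is_stratification] determine each other, so the two constructions are mutually
inverse. *)

Set Implicit Arguments.
Unset Strict Implicit.
Unset Printing Implicit Defensive.

Local Open Scope classical_set_scope.

(** Once the data of two records agree, only proof fields can differ, and proof irrelevance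
    identifies them. *)
Local Ltac identify_proofs :=
  repeat match goal with
  | p : ?A, q : ?A |- _ => have ? : p = q by [exact: Prop_irrelevance]; subst q
  end.

(** * Equality of structures linked by a map that is the identity on [U] *)

Section Extensionality.
Variable U : Type.

(** An element of a set carries its membership proof, so even an inclusion has to be a map; this one
    replaces the proof and leaves the value unchanged by computation. *)
Definition incl (A B : set U) (sAB : A `<=` B) (a : A) : B :=
  exist _ (\val a) (mem_set (sAB _ (set_valP a))).

Lemma val_preserving_inj (A B : set U) (h : A -> B) :
  (forall a, \val (h a) = \val a) -> injective h.
Proof. by move=> hval a b hab; apply: val_inj; rewrite -!hval hab. Qed.

Lemma bahom_comp (A B D : boolalg U) (g : B -> D) (f : A -> B) :
  is_bahom g -> is_bahom f -> is_bahom (g \o f).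
Proof.
move=> [gm gj gc gb gt] [fm fj fc fb ft].
by split=> [a b|a b|a||] /=; rewrite ?fm ?fj ?fc ?fb ?ft.
Qed.

Lemma bahom_cancel (A B D : boolalg U) (g : B -> D) (f : A -> B) :
  injective g -> is_bahom g -> is_bahom (g \o f) -> is_bahom f.
Proof.
move=> ginj [gm gj gc gb gt] [fm fj fc fb ft].
split=> [a b|a b|a||]; apply: ginj; rewrite ?gm ?gj ?gc ?gb ?gt //.
- exact: fm.
- exact: fj.
- exact: fc.
Qed.

Lemma bahom_ble (A B : boolalg U) (h : A -> B) (a b : A) :
  injective h -> is_bahom h -> ble (h a) (h b) <-> ble a b.
Proof. by move=> hinj [hm _ _ _ _]; rewrite /ble -hm; split=> [/hinj|->]. Qed.

(** Preserving values and being surjective force the two carriers to be the same subset of [U]. Then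
    [h] is the identity, and the homomorphism laws equate the operations. *)
Lemma boolalg_ext (A B : boolalg U) (h : A -> B) :
  (forall a, \val (h a) = \val a) -> (forall b, exists a, h a = b) ->
  is_bahom h -> A = B.
Proof.
move=> hval hsurj.
have eAB : A = B :> set U.
  apply/seteqP; split=> x.
    move=> Ax; rewrite -[x]/(\val (exist _ x (mem_set Ax) : A)) -hval.
    exact: set_valP.
  move=> Bx; have [a ha] := hsurj (exist _ x (mem_set Bx)).
  by have := hval a; rewrite ha /= => ->; exact: set_valP.
(* The operations and [h] have types that depend on the carriers, so the records are opened before
   the carriers are identified. *)
case: A B h hval eAB {hsurj} => [A m1 j1 c1 b1 t1 p1 p2 p3 p4 p5 p6 p7 p8 p9 p10 p11].
case=> [B m2 j2 c2 b2 t2 q1 q2 q3 q4 q5 q6 q7 q8 q9 q10 q11] /= h hval eAB.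
subst B.
have hE a : h a = a by exact/val_inj/hval.
case=> /= hm hj hc; rewrite !hE => hb ht.
have e1 : m1 = m2 by apply/funext => a; apply/funext => b; have := hm a b; rewrite !hE.
have e2 : j1 = j2 by apply/funext => a; apply/funext => b; have := hj a b; rewrite !hE.
have e3 : c1 = c2 by apply/funext => a; have := hc a; rewrite !hE.
subst m2 j2 c2 b2 t2.
by identify_proofs.
Qed.

Variable C : fpcategory.

Lemma bafunctor_ext (P Q : bafunctor C U) (h : forall X, P X -> Q X) :
  (forall X a, \val (h X a) = \val a) -> (forall X b, exists a, h X a = b) ->
  is_nattrans h -> P = Q.
Proof.
move=> hval hsurj [hhom hnat].
have eob : fobj P = fobj Q.
  by apply/funext => X; exact: boolalg_ext (hval X) (hsurj X) (hhom X).
case: P Q h hval hnat eob {hsurj hhom} => [P f1 p1 p2 p3] [Q f2 q1 q2 q3] /=.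
move=> h hval hnat eob; subst Q.
have hE X a : h X a = a by exact/val_inj/hval.
have e : f1 = f2.
  apply: functional_extensionality_dep => X'.
  apply: functional_extensionality_dep => X.
  apply: functional_extensionality_dep => f; apply/funext => a.
  by have := hnat _ _ f a; rewrite !hE.
by subst f2; identify_proofs.
Qed.

(** Quantifiers and fragments are typed over the underlying functor, so the functors are identified
    first. After that [h] is the identity, and the last two hypotheses compare objects of equal
    type. *)
Lemma fo_doctrine_qf_ext (P Q : fo_doctrine_qf C U) (h : forall X, P X -> Q X) :
  (forall X a, \val (h X a) = \val a) -> (forall X b, exists a, h X a = b) ->
  is_nattrans h ->
  (forall X Y (b : P (prodo X Y)), h X (fo_all P b) = fo_all Q (h _ b)) ->
  (forall X a, foqf_fragment (h X a) <-> foqf_fragment a) ->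
  P = Q.
Proof.
move=> hval hsurj hnat.
have eob : P = Q :> bafunctor C U by exact: bafunctor_ext hval hsurj hnat.
case: P Q h hval eob {hsurj hnat} => [[P a1 p1 p2] F1 p3] [[Q a2 q1 q2] F2 q3] /=.
move=> h hval eob hall hfrag; subst Q.
have hE X a : h X a = a by exact/val_inj/hval.
have e : a1 = a2.
  apply: functional_extensionality_dep => X.
  apply: functional_extensionality_dep => Y; apply/funext => b.
  by have := hall _ _ b; rewrite !hE.
subst a2.
have e : F1 = F2.
  apply: functional_extensionality_dep => X; apply/funext => a; apply/propext.
  by have := hfrag _ a; rewrite hE => -[? ?]; split.
subst F2.
by identify_proofs.
Qed.

Lemma qa_one_step_ext (P Q : bafunctor C U) (s t : qa_one_step P Q) :
  (forall X a, os_incl s a = os_incl t a :> Q X) ->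
  (forall X Y (b : P (prodo X Y)), os_all s b = os_all t b) -> s = t.
Proof.
case: s t => [i1 p1 p2 a1 p3 p4 p5] [i2 q1 q2 a2 q3 q4 q5] /= ei ea.
have e : i1 = i2 by apply: functional_extensionality_dep => X; apply/funext.
subst i2.
have e : a1 = a2.
  apply: functional_extensionality_dep => X.
  by apply: functional_extensionality_dep => Y; apply/funext.
by subst a2; identify_proofs.
Qed.

Lemma qa_stratified_sub_ext (S T : qa_stratified_sub C U)
    (h : forall n X, S n X -> T n X) :
  (forall n X a, \val (h n X a) = \val a) ->
  (forall n X b, exists a, h n X a = b) ->
  (forall n, is_nattrans (h n)) ->
  (forall n X Y (b : S n (prodo X Y)),
     h n.+1 X (os_all (qa_step S n) b) = os_all (qa_step T n) (h n _ b)) ->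
  S = T.
Proof.
move=> hval hsurj hnat.
have elev : qa_level S = qa_level T.
  by apply/funext => n; exact: bafunctor_ext (hval n) (hsurj n) (hnat n).
case: S T h hval elev {hsurj hnat} => [[L s1 p1] p2] [[M s2 q1] q2] /=.
move=> h hval elev hall; subst M.
have hE n X a : h n X a = a by exact/val_inj/hval.
have e : s1 = s2.
  apply: functional_extensionality_dep => n.
  (* Both inclusions keep the underlying element of [U], which settles their equality. *)
  apply: qa_one_step_ext => [X a|X Y b]; first by apply: val_inj; rewrite p2 q2.
  by have := hall _ _ _ b; rewrite !hE.
subst s2.
by identify_proofs.
Qed.

End Extensionality.

(** * A doctrine with fragment and its stratification determine each other *)

Section Uniqueness.
Variables (C : fpcategory) (U : Type).

(** Level [n] of [S] and of [T] both embed onto the same layer of [P]. The comparison map [h]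
    satisfies [k \o h = j], and the injectivity of [k] transfers all structure to [h]. *)
Lemma is_stratification_functional (P : fo_doctrine_qf C U)
    (S T : qa_stratified_sub C U) :
  is_stratification P S -> is_stratification P T -> S = T.
Proof.
move=> [j [jval jran jnat jall]] [k [kval kran knat kall]].
have kinj n X : injective (k n X) by exact: val_preserving_inj.
have sST n X : S n X `<=` T n X.
  move=> x Sx; have : range (k n X) (j n X (exist _ x (mem_set Sx))).
    by rewrite kran -jran; exists (exist _ x (mem_set Sx)).
  by case=> b _ /(congr1 \val); rewrite jval kval /= => <-; exact: set_valP.
pose h n X := incl (sST n X).
have kh n X a : k n X (h n X a) = j n X a by apply: val_inj; rewrite kval jval.
apply: (@qa_stratified_sub_ext _ _ _ _ h) => [n X a|n X b|n|n X Y b].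
- by [].
- have : range (j n X) (k n X b) by rewrite jran -kran; exists b.
  by case=> a _ ab; exists a; apply: kinj; rewrite kh.
- have [khom knt] := knat n; have [jhom jnt] := jnat n.
  split=> [X|X' X f a].
    apply: (bahom_cancel (@kinj n X) (khom X)).
    by have -> : k n X \o h n X = j n X by apply/funext => a; exact: kh.
  by apply: kinj; rewrite knt !kh jnt.
- by apply: kinj; rewrite kall !kh jall.
Qed.

Lemma qa_level_mono (S : qa_stratified_sub C U) m n X : m <= n ->
  S m X `<=` S n X.
Proof.
elim: n => [|n IHn]; first by rewrite leqn0 => /eqP ->.
rewrite leq_eqVlt => /predU1P[->//|/IHn {}IHn] x /IHn Snx.
rewrite -[x]/(\val (exist _ x (mem_set Snx) : S n X)) -qas_subset.
exact: set_valP.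
Qed.

(** Each law involves at most two elements, which come from one level, where both [j n] and
    [h \o j n] are homomorphisms. The constants are read at level 0. *)
Lemma bahom_directed_union (L : nat -> boolalg U) (A B : boolalg U)
    (j : forall n, L n -> A) (h : A -> B) :
  (forall a b, exists n x y, a = j n x /\ b = j n y) ->
  (forall n, is_bahom (j n)) -> (forall n, is_bahom (h \o j n)) -> is_bahom h.
Proof.
move=> jdir jhom hjhom.
split=> [a b|a b|a||].
- have [n [x [y [-> ->]]]] := jdir a b.
  by have [jm _ _ _ _] := jhom n; have [hm _ _ _ _] := hjhom n; rewrite -jm; exact: hm.
- have [n [x [y [-> ->]]]] := jdir a b.
  by have [_ jm _ _ _] := jhom n; have [_ hm _ _ _] := hjhom n; rewrite -jm; exact: hm.
- have [n [x [_ [-> _]]]] := jdir a a.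
  by have [_ _ jm _ _] := jhom n; have [_ _ hm _ _] := hjhom n; rewrite -jm; exact: hm.
- by have [_ _ _ jm _] := jhom 0; have [_ _ _ hm _] := hjhom 0; rewrite -jm; exact: hm.
- by have [_ _ _ _ jm] := jhom 0; have [_ _ _ _ hm] := hjhom 0; rewrite -jm; exact: hm.
Qed.

(** By exhaustion every element of [P] or [Q] comes from some level of [S], so the two have the same
    elements, and each operation can be checked on a level. *)
Lemma is_stratification_injective (P Q : fo_doctrine_qf C U)
    (S : qa_stratified_sub C U) :
  is_stratification P S -> is_stratification Q S -> P = Q.
Proof.
move=> [j [jval jran jnat jall]] [k [kval kran knat kall]].
have jinj n X : injective (j n X) by exact: val_preserving_inj.
have kinj n X : injective (k n X) by exact: val_preserving_inj.
have jsurj X (p : P X) : exists n x, p = j n X x.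
  have : (\bigcup_n layer (@foqf_fragment _ _ P) n X) p.
    by rewrite (qf_exhaust (foqf_is_fragment P)).
  by case=> n _; rewrite -jran => -[x _ <-]; exists n, x.
have ksurj X (q : Q X) : exists n x, q = k n X x.
  have : (\bigcup_n layer (@foqf_fragment _ _ Q) n X) q.
    by rewrite (qf_exhaust (foqf_is_fragment Q)).
  by case=> n _; rewrite -kran => -[x _ <-]; exists n, x.
have jdir X (p q : P X) : exists n x y, p = j n X x /\ q = j n X y.
  have [m [x ->]] := jsurj X p; have [n [y ->]] := jsurj X q.
  exists (maxn m n), (incl (qa_level_mono (leq_maxl m n)) x).
  exists (incl (qa_level_mono (leq_maxr m n)) y).
  by split; apply: val_inj; rewrite !jval.
have sPQ X : P X `<=` Q X.
  move=> x Px; have [n [y /(congr1 \val)]] := jsurj X (exist _ x (mem_set Px)).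
  by rewrite jval -kval /= => ->; exact: set_valP.
pose h X := incl (sPQ X).
have hj n X x : h X (j n X x) = k n X x by apply: val_inj; rewrite kval -jval.
apply: (@fo_doctrine_qf_ext _ _ _ _ h) => [//|X q||X Y p|X p].
- by have [n [x ->]] := ksurj X q; exists (j n X x).
- split=> [X|X' X f p].
    apply: (bahom_directed_union (jdir X)) => n; first by have [] := jnat n.
    have -> : h X \o j n X = k n X by apply/funext => x; exact: hj.
    by have [] := knat n.
  have [n [x ->]] := jsurj X p.
  have [_ jn] := jnat n; have [_ kn] := knat n.
  by rewrite -jn !hj kn.
- by have [n [x ->]] := jsurj _ p; rewrite -jall !hj kall.
(* Layer 0 is the fragment itself, so the ranges at level 0 recover both fragments. *)
- have jr := jran 0 X; have kr := kran 0 X; rewrite /= in jr kr.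
  rewrite -jr -kr; split=> -[x _ e]; exists x => //.
    by apply: val_inj; rewrite jval -kval e.
  by rewrite -e hj.
Qed.

End Uniqueness.

(** * Generated subalgebras and their images under homomorphisms *)

Lemma generated_subalg (U : Type) (A : boolalg U) (G : set A) : is_subalg (generated G).
Proof.
split=> [a b Ga Gb M MG|a b Ga Gb M MG|a Ga M MG|M MG|M MG].
- by have [[mm _ _ _ _] _] := MG; apply: mm; [exact: Ga|exact: Gb].
- by have [[_ mj _ _ _] _] := MG; apply: mj; [exact: Ga|exact: Gb].
- by have [[_ _ mc _ _] _] := MG; apply: mc; exact: Ga.
- by have [[_ _ _ mb _] _] := MG.
- by have [[_ _ _ _ mt] _] := MG.
Qed.

Section Generation.
Variables (U : Type) (A B : boolalg U) (h : A -> B).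
Hypothesis hhom : is_bahom h.

Lemma image_subalg (M : set A) : is_subalg M -> is_subalg (h @` M).
Proof.
move=> [mm mj mc mb mt]; have [hm hj hc hb ht] := hhom.
split=> [_ _ [a Ma <-] [b Mb <-]|_ _ [a Ma <-] [b Mb <-]|_ [a Ma <-]||].
- by rewrite -hm; apply: imageP; exact: mm.
- by rewrite -hj; apply: imageP; exact: mj.
- by rewrite -hc; apply: imageP; exact: mc.
- by rewrite -hb; apply: imageP.
- by rewrite -ht; apply: imageP.
Qed.

Lemma preimage_subalg (M : set B) : is_subalg M -> is_subalg (h @^-1` M).
Proof.
move=> [mm mj mc mb mt]; have [hm hj hc hb ht] := hhom.
split=> [a b Ma Mb|a b Ma Mb|a Ma||] /=.
- by rewrite hm; exact: mm.
- by rewrite hj; exact: mj.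
- by rewrite hc; exact: mc.
- by rewrite hb.
- by rewrite ht.
Qed.

(** Each inclusion is an instance of minimality: one against the preimage of the subalgebra on the
    right, the other against the image of the one on the left. *)
Lemma image_generated (G : set A) : h @` generated G = generated (h @` G).
Proof.
apply/seteqP; split.
  move=> _ [a Ga <-]; apply: (Ga (h @^-1` generated (h @` G))); split.
    exact/preimage_subalg/generated_subalg.
  by move=> b Gb; apply: sub_gen_smallest; exact: imageP.
apply: smallest_sub; first exact/image_subalg/generated_subalg.
by apply: image_subset; exact: sub_gen_smallest.
Qed.

End Generation.

(** * A subalgebra as a Boolean algebra in its own right *)

Section Subalgebra.
Variables (U : Type) (A : boolalg U) (R : set A).
Hypothesis subR : is_subalg R.

(** [R] consists of elements of [A], but a carrier consists of elements of [U]; passing to values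
    makes the subalgebra a literal subset of [A]. *)
Let Z : set U := \val @` R.

Lemma subalg_carrier_sub : Z `<=` A.
Proof. by move=> _ [a _ <-]; exact: set_valP. Qed.

Definition subalg_val : Z -> A := incl subalg_carrier_sub.

Definition subalg_mk (a : A) (Ra : R a) : Z :=
  exist _ (\val a) (mem_set (imageP \val Ra)).

Lemma subalg_mkK a (Ra : R a) : subalg_val (subalg_mk Ra) = a.
Proof. exact: val_inj. Qed.

Lemma subalg_val_inj : injective subalg_val.
Proof. exact: val_preserving_inj. Qed.

Lemma subalg_valP x : R (subalg_val x).
Proof.
have [a Ra e] := set_valP x.
by have -> : subalg_val x = a by exact: val_inj.
Qed.

Lemma range_subalg_val : range subalg_val = R.
Proof.
apply/seteqP; split=> [_ [x _ <-]|a Ra]; first exact: subalg_valP.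
by exists (subalg_mk Ra); rewrite ?subalg_mkK.
Qed.

Let subR_meet x y : R (meet (subalg_val x) (subalg_val y)).
Proof. by have [mm _ _ _ _] := subR; apply: mm; exact: subalg_valP. Qed.
Let subR_join x y : R (join (subalg_val x) (subalg_val y)).
Proof. by have [_ mj _ _ _] := subR; apply: mj; exact: subalg_valP. Qed.
Let subR_compl x : R (compl (subalg_val x)).
Proof. by have [_ _ mc _ _] := subR; apply: mc; exact: subalg_valP. Qed.
Let subR_bot : R (bot A). Proof. by case: subR. Qed.
Let subR_top : R (top A). Proof. by case: subR. Qed.

(** Each law is checked after the injection [subalg_val], where it is the law of [A]. The operations
    stay transparent while [abstract] seals the proofs. *)
Definition subalg : boolalg U.
Proof.
refine (@BoolAlg U Z (fun x y => subalg_mk (subR_meet x y))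
  (fun x y => subalg_mk (subR_join x y)) (fun x => subalg_mk (subR_compl x))
  (subalg_mk subR_bot) (subalg_mk subR_top) _ _ _ _ _ _ _ _ _ _ _);
  abstract (move=> *; apply: subalg_val_inj; rewrite !subalg_mkK;
  by [exact: meetC|exact: joinC|exact: meetA|exact: joinA|exact: meet_absorb
     |exact: join_absorb|exact: meet_joinl|exact: join0b|exact: meet1b
     |exact: meet_compl|exact: join_compl]).
Defined.

Lemma subalg_val_bahom : @is_bahom U subalg A subalg_val.
Proof. by split=> [x y|x y|x||]; exact: subalg_mkK. Qed.

End Subalgebra.

(** * Subfunctors given by subalgebras stable under reindexing *)

Section Subfunctor.
Variables (C : fpcategory) (U : Type) (P : bafunctor C U) (R : forall X, set (P X)).
Arguments R X : clear implicits.
Hypothesis subR : forall X, is_subalg (R X).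
Hypothesis fmapR : forall X' X (f : hom X' X) a, R X a -> R X' (fmap P f a).

Definition subfunctor_val X : subalg (subR X) -> P X :=
  @subalg_val U (P X) (R X).

Lemma subfunctor_val_inj X : injective (@subfunctor_val X).
Proof. exact: val_preserving_inj. Qed.

Definition subfunctor_fmap X' X (f : hom X' X) (x : subalg (subR X)) :
    subalg (subR X') :=
  subalg_mk (fmapR f (subalg_valP x)).

Lemma subfunctor_fmapE X' X (f : hom X' X) (x : subalg (subR X)) :
  subfunctor_val (subfunctor_fmap f x) = fmap P f (subfunctor_val x).
Proof. exact: subalg_mkK. Qed.

Definition subfunctor : bafunctor C U.
Proof.
refine (@BAFunctor C U (fun X => subalg (subR X)) subfunctor_fmap _ _ _).
- abstract (move=> X' X f;
  apply: (@bahom_cancel _ _ (subalg (subR X')) _ _ _ (@subalg_val_inj _ _ _)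
    (subalg_val_bahom (subR X')));
  have -> : @subfunctor_val X' \o subfunctor_fmap f = fmap P f \o @subfunctor_val X
    by [apply/funext => x; exact: subfunctor_fmapE];
  exact: bahom_comp (fmap_bahom _ f) (subalg_val_bahom (subR X))).
- abstract (by move=> X a; apply: subfunctor_val_inj; rewrite subfunctor_fmapE fmap_id).
- abstract (by move=> X'' X' X f g a; apply: subfunctor_val_inj;
  rewrite !subfunctor_fmapE fmap_comp).
Defined.

Lemma subfunctor_val_nattrans : @is_nattrans C U subfunctor P subfunctor_val.
Proof.
by split=> [X|X' X f x]; [exact: subalg_val_bahom|exact: subfunctor_fmapE].
Qed.

End Subfunctor.

(** Maps that commute with the quantifiers carry the generators of a level onto those of a layer.
    Both constructions rely on this to match the generation axiom with the definition of [layer]. *)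
Lemma image_bigcup_all (C : fpcategory) (U : Type) (P : fo_doctrine C U)
    (L M : C -> boolalg U) (X : C) (all : forall Y, L (prodo X Y) -> M X)
    (j : forall Z, L Z -> P Z) (k : M X -> P X) :
  (forall Y b, k (all Y b) = fo_all P (j _ b)) ->
  k @` (\bigcup_(Y : C) range (all Y)) =
  \bigcup_(Y : C) (@fo_all _ _ P X Y @` range (j (prodo X Y))).
Proof.
move=> kall; apply/seteqP; split.
  by move=> _ [_ [Y _ [b _ <-]] <-]; exists Y => //; exists (j _ b) => //; exists b.
move=> _ [Y _ [_ [b _ <-] <-]]; exists (all Y b); last exact: kall.
by exists Y => //; exists b.
Qed.

(** * From a doctrine with fragment to a stratified doctrine *)

Section Layers.
Variables (C : fpcategory) (U : Type) (P : fo_doctrine C U).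
Variable P0 : forall X, set (P X).
Arguments P0 X : clear implicits.
Hypothesis P0_qf : is_qf_fragment P0.

Lemma layer_subalg n X : is_subalg (layer P0 n X).
Proof.
case: n => [|n]; [exact: qf_subalg P0_qf X|exact: generated_subalg].
Qed.

(** By Beck-Chevalley, a reindexed generator is the quantification of a reindexed element of the
    layer below. Elements sent into the layer form a subalgebra, so minimality covers the rest. *)
Lemma layer_fmap n X' X (f : hom X' X) a :
  layer P0 n X a -> layer P0 n X' (fmap P f a).
Proof.
elim: n X' X f a => [|n IHn] X' X f a; first exact: (qf_fmap P0_qf).
move=> La; apply: (La (fmap P f @^-1` layer P0 n.+1 X')); split.
  exact: (preimage_subalg (fmap_bahom P f) (layer_subalg n.+1 X')).
move=> _ [Y _ [b Lb <-]] /=; apply: sub_gen_smallest; exists Y => //.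
by rewrite fo_bc; exists (fmap P (prodid f Y) b) => //; exact: IHn.
Qed.

(* The right adjoint of the reindexing map of the isomorphism [X x 1 -> X] is
   its inverse. *)
Lemma fo_all_termo X (a : P X) : fo_all P (fmap P (pr1 X (termo C)) a) = a.
Proof.
have bb (A : boolalg U) (b : A) : ble b b.
  by rewrite /ble -{2}(join_absorb b b) meet_absorb.
set b := fmap P _ a; have le1 : ble a (fo_all P b) by apply/fo_adj; exact: bb.
(* [s] is a section of [pr1]; reindexing the counit of the adjunction along it gives the reverse
   inequality. *)
pose s : hom X (prodo X (termo C)) := pairing (idm X) (bang X).
have le2 : ble (fo_all P b) a.
  have /fo_adj le : ble (fo_all P b) (fo_all P b) by exact: bb.
  have [hm _ _ _ _] := fmap_bahom P s.
  move: le; rewrite /ble => /(congr1 (fmap P s)); rewrite hm /b -!fmap_comp.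
  by rewrite pair1 !fmap_id.
by rewrite -le2 meetC le1.
Qed.

Lemma layer_succ n X : layer P0 n X `<=` layer P0 n.+1 X.
Proof.
move=> a La; apply: sub_gen_smallest; exists (termo C) => //.
exists (fmap P (pr1 X (termo C)) a); last exact: fo_all_termo.
exact: layer_fmap.
Qed.

Definition layer_functor n : bafunctor C U :=
  subfunctor (layer_subalg n) (@layer_fmap n).

Definition layer_val n X : layer_functor n X -> P X :=
  @subfunctor_val _ _ _ _ (layer_subalg n) X.

Lemma layer_val_inj n X : injective (@layer_val n X).
Proof. exact: subfunctor_val_inj. Qed.

Lemma layer_val_nattrans n : is_nattrans (@layer_val n).
Proof. exact: subfunctor_val_nattrans. Qed.

Lemma layer_valP n X (x : layer_functor n X) : layer P0 n X (layer_val x).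
Proof. exact: subalg_valP. Qed.

Lemma range_layer_val n X : range (@layer_val n X) = layer P0 n X.
Proof. exact: range_subalg_val. Qed.

Lemma layer_all_subproof n X Y (b : layer_functor n (prodo X Y)) :
  layer P0 n.+1 X (fo_all P (layer_val b)).
Proof.
apply: sub_gen_smallest; exists Y => //.
by apply: imageP; exact: layer_valP.
Qed.

Definition layer_incl n X (x : layer_functor n X) : layer_functor n.+1 X :=
  subalg_mk (layer_succ (layer_valP x)).

Definition layer_all n X Y (b : layer_functor n (prodo X Y)) :
    layer_functor n.+1 X :=
  subalg_mk (layer_all_subproof b).

Lemma layer_inclE n X (x : layer_functor n X) :
  layer_val (layer_incl x) = layer_val x.
Proof. exact: subalg_mkK. Qed.

Lemma layer_allE n X Y (b : layer_functor n (prodo X Y)) :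
  layer_val (layer_all b) = fo_all P (layer_val b).
Proof. exact: subalg_mkK. Qed.

Lemma layer_incl_nattrans n : is_nattrans (@layer_incl n).
Proof.
have [khom knat] := layer_val_nattrans n.
have [hom' nat'] := layer_val_nattrans n.+1.
split=> [X|X' X f a]; last first.
  by apply: layer_val_inj; rewrite layer_inclE knat nat' layer_inclE.
apply: (bahom_cancel (@layer_val_inj _ _) (hom' X)).
have -> // : @layer_val n.+1 X \o @layer_incl n X = @layer_val n X.
by apply/funext => x; exact: layer_inclE.
Qed.

Lemma layer_incl_inj n X : injective (@layer_incl n X).
Proof.
by move=> a b /(congr1 (@layer_val _ _)); rewrite !layer_inclE => /layer_val_inj.
Qed.

(** The embeddings into [P] reflect the order, so this is the adjunction of [P] read inside layer
    [n.+1]. *)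
Lemma layer_all_adj n X Y (b : layer_functor n (prodo X Y)) (a : layer_functor n.+1 X) :
  ble a (layer_all b) <-> ble (fmap (layer_functor n.+1) (pr1 X Y) a) (layer_incl b).
Proof.
have [hom' nat'] := layer_val_nattrans n.+1.
rewrite -(bahom_ble _ _ (@layer_val_inj _ _) (hom' X)).
rewrite -(bahom_ble _ _ (@layer_val_inj _ _) (hom' (prodo X Y))).
by rewrite nat' layer_inclE layer_allE; exact: fo_adj.
Qed.

Lemma layer_all_bc n X' X (f : hom X' X) Y (b : layer_functor n (prodo X Y)) :
  fmap (layer_functor n.+1) f (layer_all b) =
  layer_all (fmap (layer_functor n) (prodid f Y) b).
Proof.
have [_ knat] := layer_val_nattrans n; have [_ nat'] := layer_val_nattrans n.+1.
by apply: layer_val_inj; rewrite nat' !layer_allE fo_bc knat.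
Qed.

(** After the embedding into [P], the generated subalgebra becomes layer [n.+1] by definition;
    injectivity of the embedding brings the equality back. *)
Lemma layer_all_gen n X :
  generated (\bigcup_(Y : C) range (@layer_all n X Y)) = setT.
Proof.
have [hom' _] := layer_val_nattrans n.+1.
rewrite -subTset => x _.
have : layer P0 n.+1 X (layer_val x) by exact: layer_valP.
have <- : @layer_val n.+1 X @` generated (\bigcup_(Y : C) range (@layer_all n X Y)) =
    layer P0 n.+1 X.
  rewrite (image_generated (hom' X)) (image_bigcup_all (@layer_allE n X)) /=.
  by congr generated; apply: eq_bigcupr => Y _; rewrite range_layer_val.
by case=> y Gy /layer_val_inj <-.
Qed.

Definition layer_one_step n : qa_one_step (layer_functor n) (layer_functor n.+1) :=
  QAOneStep (layer_incl_nattrans n) (@layer_incl_inj n) (@layer_all_adj n)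
    (@layer_all_bc n) (@layer_all_gen n).

Lemma layer_all_incl n X Y (b : layer_functor n (prodo X Y)) :
  layer_incl (layer_all b) = layer_all (layer_incl b).
Proof. by apply: layer_val_inj; rewrite layer_inclE !layer_allE layer_inclE. Qed.

Definition layer_stratified : qa_stratified_sub C U :=
  @QAStratifiedSub _ _ (@QAStratified _ _ layer_functor layer_one_step layer_all_incl)
    (* [layer_incl] keeps the underlying element by computation. *)
    (fun n X a => erefl).

End Layers.

Lemma is_stratification_layer (C : fpcategory) (U : Type) (P : fo_doctrine_qf C U) :
  is_stratification P (layer_stratified (foqf_is_fragment P)).
Proof.
exists (fun n X => @layer_val _ _ _ _ (foqf_is_fragment P) n X).
split=> // [n X|n|n X Y b].
- exact: range_layer_val.
- exact: layer_val_nattrans.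
- exact: layer_allE.
Qed.

(** * Functions on the union of an increasing chain of sets *)

Section Chain.
Variables (U : Type) (A : nat -> set U).
Hypothesis Amono : forall n, A n `<=` A n.+1.

Definition chain_in n : A n -> \bigcup_n A n := incl (@bigcup_sup _ _ n setT A Logic.I).

Lemma chain_mono m n : m <= n -> A m `<=` A n.
Proof.
exact: (@homo_leq _ A (fun B D => B `<=` D) (@subset_refl _)
  (fun _ _ _ => @subset_trans _ _ _ _) Amono).
Qed.

Lemma chain_in_lift m n (le : m <= n) (a : A m) :
  chain_in a = chain_in (incl (chain_mono le) a).
Proof. exact: val_inj. Qed.

Lemma chain_in_surj x : exists n (a : A n), x = chain_in a.
Proof.
have [n _ Ax] := set_valP x; by exists n, (exist _ (\val x) (mem_set Ax)); exact: val_inj.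
Qed.

Lemma chain_in_surj2 x y : exists n (a b : A n), x = chain_in a /\ y = chain_in b.
Proof.
have [m [a ->]] := chain_in_surj x; have [n [b ->]] := chain_in_surj y.
exists (maxn m n), (incl (chain_mono (leq_maxl m n)) a).
exists (incl (chain_mono (leq_maxr m n)) b).
by split; exact: chain_in_lift.
Qed.

Lemma chain_in_surj3 x y z :
  exists n (a b c : A n), [/\ x = chain_in a, y = chain_in b & z = chain_in c].
Proof.
have [m [a [b [-> ->]]]] := chain_in_surj2 x y; have [n [c ->]] := chain_in_surj z.
exists (maxn m n), (incl (chain_mono (leq_maxl m n)) a).
exists (incl (chain_mono (leq_maxl m n)) b), (incl (chain_mono (leq_maxr m n)) c).
by split; exact: chain_in_lift.
Qed.

Variables (T : Type).

(** A common level and representatives are picked by choice. This is total for every [f];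
    independence of the choice requires compatibility with the inclusions. *)
Definition chain_fun2 (f : forall n, A n -> A n -> T) (x y : \bigcup_n A n) : T :=
  let s := cid (chain_in_surj2 x y) in
  let t := cid (projT2 s) in
  f (projT1 s) (projT1 t) (projT1 (cid (projT2 t))).

Lemma chain_fun2E f n (a b : A n) :
  (forall n a b, f n.+1 (incl (@Amono n) a) (incl (@Amono n) b) = f n a b) ->
  chain_fun2 f (chain_in a) (chain_in b) = f n a b.
Proof.
move=> fS.
(* Representatives at different levels have different types, so they are compared through their
   values in [U]. *)
have flift m k (a1 b1 : A m) (a2 b2 : A k) : m <= k -> \val a1 = \val a2 ->
    \val b1 = \val b2 -> f m a1 b1 = f k a2 b2.
  elim: k a2 b2 => [|k IHk] a2 b2.
    by rewrite leqn0 => /eqP e; subst m => /val_inj -> /val_inj ->.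
  rewrite leq_eqVlt ltnS => /predU1P[e|le]; first by subst m => /val_inj -> /val_inj ->.
  move=> e1 e2.
  have A1 : A k (\val a2) by rewrite -e1; apply: (chain_mono le); exact: set_valP.
  have A2 : A k (\val b2) by rewrite -e2; apply: (chain_mono le); exact: set_valP.
  rewrite (IHk (exist _ (\val a2) (mem_set A1)) (exist _ (\val b2) (mem_set A2)) le e1 e2) -fS.
  by congr (f k.+1); exact: val_inj.
rewrite /chain_fun2; case: (cid (chain_in_surj2 _ _)) => /= m mP.
case: cid => /= a' a'P; case: cid => b' /= [/(congr1 \val) /= e1 /(congr1 \val) /= e2].
(* The chosen level [m] may lie below or above [n]. *)
by have [le|/ltnW le] := leqP m n; [|symmetry]; exact: flift.
Qed.

(** Defined on the diagonal, so that the choice argument is made only once. *)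
Definition chain_fun (f : forall n, A n -> T) (x : \bigcup_n A n) : T :=
  chain_fun2 (fun n a _ => f n a) x x.

Lemma chain_funE f n (a : A n) :
  (forall n a, f n.+1 (incl (@Amono n) a) = f n a) ->
  chain_fun f (chain_in a) = f n a.
Proof. by move=> fS; rewrite /chain_fun chain_fun2E. Qed.

End Chain.

(** * The Boolean algebra on the union of a chain of Boolean algebras *)

Section UnionAlgebra.
Variables (U : Type) (L : nat -> boolalg U).
Hypothesis Lmono : forall n, L n `<=` L n.+1.
Hypothesis Lhom : forall n, @is_bahom U (L n) (L n.+1) (incl (@Lmono n)).

Let V : set U := \bigcup_n L n.
Let inV n (a : L n) : V := @chain_in U L n a.

Let inV_incl n (a : L n) : inV (incl (@Lmono n) a : L n.+1) = inV a.
Proof. exact: val_inj. Qed.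

Definition union_meet : V -> V -> V :=
  chain_fun2 Lmono (fun n (a b : L n) => inV (meet a b)).
Definition union_join : V -> V -> V :=
  chain_fun2 Lmono (fun n (a b : L n) => inV (join a b)).
Definition union_compl : V -> V := chain_fun Lmono (fun n (a : L n) => inV (compl a)).
Definition union_bot : V := inV (bot (L 0)).
Definition union_top : V := inV (top (L 0)).

(** Independence of the level is the homomorphism property of the inclusions. With such formulas,
    each law of the union reduces to the same law at a level common to the elements involved. *)
Let meetE n (a b : L n) : union_meet (inV a) (inV b) = inV (meet a b).
Proof.
by apply: chain_fun2E => m x y; have [hm _ _ _ _] := Lhom m; rewrite -[RHS]inV_incl hm.
Qed.

Let joinE n (a b : L n) : union_join (inV a) (inV b) = inV (join a b).
Proof.
by apply: chain_fun2E => m x y; have [_ hj _ _ _] := Lhom m; rewrite -[RHS]inV_incl hj.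
Qed.

Let complE n (a : L n) : union_compl (inV a) = inV (compl a).
Proof.
by apply: chain_funE => m x; have [_ _ hc _ _] := Lhom m; rewrite -[RHS]inV_incl hc.
Qed.

(** The constant is taken from level 0; the inclusions carry it to the constant of every level. *)
Let botE n : union_bot = inV (bot (L n)).
Proof. by elim: n => // n ->; have [_ _ _ hb _] := Lhom n; rewrite -[LHS]inV_incl hb. Qed.

Let topE n : union_top = inV (top (L n)).
Proof. by elim: n => // n ->; have [_ _ _ _ ht] := Lhom n; rewrite -[LHS]inV_incl ht. Qed.

Let meetC' : commutative union_meet.
Proof.
by move=> x y; have [n [a [b [-> ->]]]] := chain_in_surj2 Lmono x y; rewrite !meetE meetC.
Qed.
Let joinC' : commutative union_join.
Proof.
by move=> x y; have [n [a [b [-> ->]]]] := chain_in_surj2 Lmono x y; rewrite !joinE joinC.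
Qed.
Let meetA' : associative union_meet.
Proof.
by move=> x y z; have [n [a [b [c [-> -> ->]]]]] := chain_in_surj3 Lmono x y z;
  rewrite !meetE meetA.
Qed.
Let joinA' : associative union_join.
Proof.
by move=> x y z; have [n [a [b [c [-> -> ->]]]]] := chain_in_surj3 Lmono x y z;
  rewrite !joinE joinA.
Qed.
Let meet_absorb' x y : union_meet x (union_join x y) = x.
Proof.
by have [n [a [b [-> ->]]]] := chain_in_surj2 Lmono x y; rewrite joinE meetE meet_absorb.
Qed.
Let join_absorb' x y : union_join x (union_meet x y) = x.
Proof.
by have [n [a [b [-> ->]]]] := chain_in_surj2 Lmono x y; rewrite meetE joinE join_absorb.
Qed.
Let meet_joinl' : left_distributive union_meet union_join.
Proof.
by move=> x y z; have [n [a [b [c [-> -> ->]]]]] := chain_in_surj3 Lmono x y z;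
  rewrite joinE !meetE joinE meet_joinl.
Qed.
Let join0b' : left_id union_bot union_join.
Proof.
by move=> x; have [n [a ->]] := chain_in_surj x; rewrite (botE n) joinE join0b.
Qed.
Let meet1b' : left_id union_top union_meet.
Proof.
by move=> x; have [n [a ->]] := chain_in_surj x; rewrite (topE n) meetE meet1b.
Qed.
Let meet_compl' x : union_meet x (union_compl x) = union_bot.
Proof.
by have [n [a ->]] := chain_in_surj x; rewrite (botE n) complE meetE meet_compl.
Qed.
Let join_compl' x : union_join x (union_compl x) = union_top.
Proof.
by have [n [a ->]] := chain_in_surj x; rewrite (topE n) complE joinE join_compl.
Qed.

Definition union_boolalg : boolalg U :=
  BoolAlg meetC' joinC' meetA' joinA' meet_absorb' join_absorb' meet_joinl'
    join0b' meet1b' meet_compl' join_compl'.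

Lemma chain_in_bahom n : @is_bahom U (L n) union_boolalg (@inV n).
Proof.
by split=> [a b|a b|a||]; rewrite ?meetE ?joinE ?complE -?botE -?topE.
Qed.

End UnionAlgebra.

(** * From a stratified doctrine to a doctrine with fragment *)

Section UnionDoctrine.
Variables (C : fpcategory) (U : Type) (S : qa_stratified_sub C U).

Let Smono X n : S n X `<=` S n.+1 X := @qa_level_mono _ _ S n n.+1 X (leqnSn n).

(** Puts the given inclusions in the form that the chain lemmas expect. *)
Let os_inclE X n : @os_incl _ _ _ _ (qa_step S n) X = incl (@Smono X n).
Proof. by apply/funext => a; apply: val_inj; exact: qas_subset. Qed.

Let Shom X n : @is_bahom U (S n X) (S n.+1 X) (incl (@Smono X n)).
Proof. by rewrite -os_inclE; have [] := os_nattrans (qa_step S n). Qed.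

Definition level_union X : boolalg U := union_boolalg (Shom X).

Definition level_in n X (a : S n X) : level_union X := @chain_in U (S ^~ X) n a.

Lemma level_in_bahom n X : is_bahom (@level_in n X).
Proof. exact: chain_in_bahom. Qed.

Lemma level_in_inj n X : injective (@level_in n X).
Proof. exact: val_preserving_inj. Qed.

Lemma level_in_incl n X (a : S n X) :
  level_in (os_incl (qa_step S n) a) = level_in a.
Proof. by apply: val_inj; exact: qas_subset. Qed.

Lemma level_in_surj X (x : level_union X) : exists n a, x = @level_in n X a.
Proof. exact: chain_in_surj. Qed.

Lemma level_in_surj2 X (x y : level_union X) :
  exists n a b, x = @level_in n X a /\ y = @level_in n X b.
Proof. exact: chain_in_surj2. Qed.

Definition union_fmap X' X (f : hom X' X) : level_union X -> level_union X' :=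
  chain_fun (@Smono X) (fun n (a : S n X) => level_in (fmap (S n) f a)).

(** Naturality of the inclusions makes the value independent of the level. *)
Lemma union_fmapE X' X (f : hom X' X) n (a : S n X) :
  union_fmap f (level_in a) = level_in (fmap (S n) f a).
Proof.
apply: chain_funE => {a}m a; have [_ nat] := os_nattrans (qa_step S m).
by rewrite -os_inclE -nat level_in_incl.
Qed.

Definition union_all X Y : level_union (prodo X Y) -> level_union X :=
  chain_fun (@Smono (prodo X Y)) (fun n b => level_in (os_all (qa_step S n) b)).

(** Here [qa_compat] gives independence of the level. *)
Lemma union_allE X Y n (b : S n (prodo X Y)) :
  union_all (level_in b) = level_in (os_all (qa_step S n) b).
Proof.
by apply: chain_funE => {b}m b; rewrite -os_inclE -qa_compat level_in_incl.
Qed.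

Lemma union_fmap_bahom X' X (f : hom X' X) : is_bahom (union_fmap f).
Proof.
apply: (bahom_directed_union (@level_in_surj2 X)) => n; first exact: level_in_bahom.
have -> : union_fmap f \o @level_in n X = @level_in n X' \o fmap (S n) f.
  by apply/funext => a; exact: union_fmapE.
exact: bahom_comp (level_in_bahom n X') (fmap_bahom _ f).
Qed.

Lemma union_fmap_id X (a : level_union X) : union_fmap (idm X) a = a.
Proof. by have [n [x ->]] := level_in_surj a; rewrite union_fmapE fmap_id. Qed.

Lemma union_fmap_comp X'' X' X (f : hom X' X) (g : hom X'' X') (a : level_union X) :
  union_fmap (compose f g) a = union_fmap g (union_fmap f a).
Proof. by have [n [x ->]] := level_in_surj a; rewrite !union_fmapE fmap_comp. Qed.

Definition union_functor : bafunctor C U :=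
  BAFunctor union_fmap_bahom union_fmap_id union_fmap_comp.

Lemma union_all_adj X Y (a : union_functor X) (b : union_functor (prodo X Y)) :
  ble a (union_all b) <-> ble (fmap union_functor (pr1 X Y) a) b.
Proof.
have [m [x ->]] := level_in_surj a; have [n [y ->]] := level_in_surj b.
(* A one-step quantifier raises the level by one, so [a] is represented one level above [b]. *)
pose x' := incl (qa_level_mono (leqW (leq_maxl m n))) x.
pose y' := incl (qa_level_mono (leq_maxr m n)) y.
have -> : level_in x = level_in (x' : S (maxn m n).+1 X) by exact: val_inj.
have -> : level_in y = level_in (y' : S (maxn m n) _) by exact: val_inj.
rewrite union_allE /= union_fmapE -(level_in_incl y').
rewrite (bahom_ble _ _ (@level_in_inj _ _) (level_in_bahom _ _)).
rewrite (bahom_ble _ _ (@level_in_inj _ _) (level_in_bahom _ _)).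
exact: os_adj.
Qed.

Lemma union_all_bc X' X (f : hom X' X) Y (b : union_functor (prodo X Y)) :
  fmap union_functor f (union_all b) = union_all (fmap union_functor (prodid f Y) b).
Proof.
have [n [x ->]] := level_in_surj b.
by rewrite /= union_allE !union_fmapE union_allE os_bc.
Qed.

Definition union_doctrine : fo_doctrine C U := FODoctrine union_all_adj union_all_bc.

Definition union_fragment X : set (union_doctrine X) := range (@level_in 0 X).

(** Induction on [n]: [os_gen] presents level [n.+1] as generated by quantified elements of level
    [n], and the embedding into the union preserves generation. *)
Lemma layer_union n X : layer union_fragment n X = range (@level_in n X).
Proof.
elim: n X => [//|n IHn] X /=.
(* The rewritten [setT] is the one hidden in [range]. *)
rewrite -(os_gen (qa_step S n) X) (image_generated (level_in_bahom _ _)).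
rewrite (image_bigcup_all (P := union_doctrine) (j := @level_in n)); last first.
  by move=> Y b; rewrite [RHS]union_allE.
apply: (congr1 (@generated U (level_union X))).
by apply: eq_bigcupr => Y _; rewrite IHn.
Qed.

Lemma union_is_qf_fragment : is_qf_fragment union_fragment.
Proof.
split=> [X|X' X f _ [x _ <-]|X].
- apply: (image_subalg (level_in_bahom 0 X)); split=> //.
- by exists (fmap (S 0) f x) => //; rewrite [RHS]union_fmapE.
- rewrite -subTset => x _; have [n [a ->]] := level_in_surj x.
  by exists n => //; rewrite layer_union; exists a.
Qed.

Definition union_doctrine_qf : fo_doctrine_qf C U := FODoctrineQF union_is_qf_fragment.

Lemma is_stratification_union : is_stratification union_doctrine_qf S.
Proof.
exists level_in; split=> // [n X|n|n X Y b].
- by rewrite -layer_union.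
- by split=> [X|X' X f a]; [exact: level_in_bahom|rewrite [RHS]union_fmapE].
- by rewrite [RHS]union_allE.
Qed.

End UnionDoctrine.

Theorem proposition3p13 (C : fpcategory) (U : Type) :
  exists F : fo_doctrine_qf C U -> qa_stratified_sub C U,
    bijective F /\ (forall P : fo_doctrine_qf C U, is_stratification P (F P)).
Proof.
pose F (P : fo_doctrine_qf C U) := layer_stratified (foqf_is_fragment P).
have FP P : is_stratification P (F P) by exact: is_stratification_layer.
(* For the first composite, both doctrines have the stratification [F P]; for the second, both
   sequences stratify the union of [S]. *)
exists F; split=> //; exists (@union_doctrine_qf C U) => [P|S].
  exact: is_stratification_injective (is_stratification_union _) (FP P).
exact: is_stratification_functional (FP _) (is_stratification_union S).
Qed.
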